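(* If $Q$ is an LC loop, then $N_\lambda(Q)=N_\mu(Q)$, and this subloop is a normal subloop of $Q$.
   Context: A loop $Q$ is an LC (left central) loop if $x(x\cdot yz)=(x\cdot xy)z$ for all $x,y,z\in Q$, i.e. $x(x(yz))=(x(xy))z$. The left nucleus is $N_\lambda(Q)=\{a\in Q;\ a(xy)=(ax)y \text{ for all } x,y\in Q\}$ and the middle nucleus is $N_\mu(Q)=\{a\in Q;\ x(ay)=(xa)y\text{ for all }x,y\in Q\}$. A subloop $S$ of $Q$ is normal if $\varphi(S)=S$ for all inner mappings $\varphi$, i.e. for all $\varphi$ in the group generated by the left translations $L_x\colon y\mapsto xy$ and right translations $R_x\colon y\mapsto yx$ that fix the unit $1$. *)

(* Defs.v *)
From HB Require Import structures.
From mathcomp Require Import all_boot.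
From mathcomp Require Import boolp classical_sets.

Set Implicit Arguments.
Unset Strict Implicit.
Unset Printing Implicit Defensive.

Local Open Scope classical_set_scope.
Local Open Scope group_scope.

(* [baseUMagmaType] only provides the operation and the constant 1, on an
   arbitrary carrier; all the loop axioms are in this mixin.  Bijectivity of the
   translations is the unique solvability of a * x = b and y * a = b. *)
HB.mixin Record BaseUMagma_isLoop Q of BaseUMagma Q := {
  loop_mul1g : left_id (1 : Q) *%g;
  loop_mulg1 : right_id (1 : Q) *%g;
  loop_ltrans_bij : forall x : Q, bijective (fun y : Q => x * y);
  loop_rtrans_bij : forall x : Q, bijective (fun y : Q => y * x)
}.

#[short(type="loopType")]
HB.structure Definition Loop := {Q of BaseUMagma_isLoop Q & BaseUMagma Q}.

Definition ltrans (Q : loopType) (x : Q) : Q -> Q := fun y => x * y.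

Definition rtrans (Q : loopType) (x : Q) : Q -> Q := fun y => y * x.

Definition LC_loop (Q : loopType) : Prop :=
  forall x y z : Q, x * (x * (y * z)) = (x * (x * y)) * z.

Definition left_nucleus (Q : loopType) : set Q :=
  [set a | forall x y : Q, a * (x * y) = (a * x) * y].

Definition middle_nucleus (Q : loopType) : set Q :=
  [set a | forall x y : Q, x * (a * y) = (x * a) * y].

Arguments left_nucleus Q : clear implicits.
Arguments middle_nucleus Q : clear implicits.

(* The last two clauses are closure under left and right division. *)
Definition subloop (Q : loopType) (S : set Q) : Prop :=
  [/\ S 1,
      forall x y : Q, S x -> S y -> S (x * y),
      forall x y : Q, S x -> S (x * y) -> S y
    & forall x y : Q, S y -> S (x * y) -> S x].

(* G is a subgroup of the symmetric group on T. *)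
Definition perm_group (T : Type) (G : set (T -> T)) : Prop :=
  [/\ G `<=` [set f | bijective f],
      G id,
      forall f g, G f -> G g -> G (f \o g)
    & forall f g, G f -> cancel f g -> cancel g f -> G g].

Definition mult_group (Q : loopType) : set (Q -> Q) :=
  smallest (@perm_group Q) (range (@ltrans Q) `|` range (@rtrans Q)).
Arguments mult_group Q : clear implicits.

Definition inner_mapping (Q : loopType) : set (Q -> Q) :=
  [set f | mult_group Q f /\ f 1 = 1].
Arguments inner_mapping Q : clear implicits.

Definition normal_subloop (Q : loopType) (S : set Q) : Prop :=
  subloop S /\ forall f, inner_mapping Q f -> f @` S = S.

(* [smallest] is an intersection, so this needs at least one permutation group
   containing the translations: the full symmetric group. *)
Lemma mult_groupP (Q : loopType) : perm_group (mult_group Q).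
Proof.
have bijG : perm_group [set f : Q -> Q | bijective f].
  split=> //=; first by exists id.
    by move=> f g; exact: bij_comp.
  by move=> f g _ fK gK; exists f.
split.
- apply: smallest_sub => // f [] [x _ <-].
    exact: loop_ltrans_bij.
  exact: loop_rtrans_bij.
- by move=> G [[]].
- move=> f g Gf Gg G GP; have [[_ _ Gcomp _] _] := GP.
  by apply: Gcomp; [exact: Gf | exact: Gg].
- move=> f g Gf fK gK G GP; have [[_ _ _ Ginv] _] := GP.
  by apply: (Ginv f) => //; exact: Gf.
Qed.

(* Main.v *)
From mathcomp Require Import all_boot.
From mathcomp Require Import boolp classical_sets.
Require Import Defs.

Set Implicit Arguments.
Unset Strict Implicit.
Unset Printing Implicit Defensive.

Local Open Scope classical_set_scope.
Local Open Scope group_scope.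

(** Write [N] for the left nucleus and [L_x] for the left translation by [x].
An LC loop has the left inverse property: every [x] has an inverse [x'] with
[L_x' = L_x^-1].  In a loop with that property the two nuclei agree: [a] lies in
the left nucleus when [L_(ax) = L_a L_x] for all [x], in the middle nucleus when
[L_(xa) = L_x L_a] for all [x], and passing to inverses exchanges these two
conditions ([left_nucleus_eq_middle]).

In an LC loop all squares lie in [N], since
[(xx)(yz) = x(x(yz)) = (x(xy))z = ((xx)y)z].
For [n] in [N], the square of [nx] is [n(x(nx))], so [x(nx)] lies in [N]; then
so does [x'(nx)], which is [x'x'] times [x(nx)].  Hence [xN = Nx] for all [x]
([nucleus_commutes]).  As elements of [N] associate in the first two positions,
it follows that every translation permutes the right cosets [Nx], and
therefore so does every element of the multiplication group.  An inner mapping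
fixes [1], hence it fixes the coset [N] of [1]. *)

Lemma mul_injl (Q : loopType) (x : Q) : injective (fun y : Q => x * y).
Proof. exact: bij_inj (loop_ltrans_bij x). Qed.

Lemma mul_injr (Q : loopType) (x : Q) : injective (fun y : Q => y * x).
Proof. exact: bij_inj (loop_rtrans_bij x). Qed.

Definition linverse (Q : loopType) (x x' : Q) : Prop :=
  (forall y, x * (x' * y) = y) /\ (forall y, x' * (x * y) = y).

Definition LIP (Q : loopType) : Prop := forall x : Q, exists x', linverse x x'.

Lemma linverse_mul (Q : loopType) (x x' : Q) :
  linverse x x' -> x * x' = 1 /\ x' * x = 1.
Proof.
by move=> [K K']; move: (K 1) (K' 1); rewrite !loop_mulg1.
Qed.

Lemma linverse_sym (Q : loopType) (x x' : Q) : linverse x x' -> linverse x' x.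
Proof. by case. Qed.

Lemma LIP_cancel (Q : loopType) (x x' : Q) :
  LIP Q -> x * x' = 1 -> forall y, x * (x' * y) = y.
Proof.
move=> /(_ x)[v xv] xx'; suff -> : x' = v by case: xv.
by apply: (@mul_injl _ x); rewrite xx'; case: (linverse_mul xv).
Qed.

Lemma left_nucleus_inv (Q : loopType) (a a' : Q) :
  linverse a a' -> left_nucleus Q a -> left_nucleus Q a'.
Proof.
by move=> [K _] Na x y; apply: (@mul_injl _ a); rewrite K Na K.
Qed.

(** The element [u] with [ua = x] stands in for [xa'], which it turns out to be:
a right inverse property is not at hand to cancel [a'] against [a]. *)
Lemma middle_nucleus_inv (Q : loopType) (a a' : Q) :
  linverse a a' -> middle_nucleus Q a -> middle_nucleus Q a'.
Proof.
move=> aa' Na x y; have [K _] := aa'; have [e _] := linverse_mul aa'.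
have [g _ gK] := loop_rtrans_bij a; have := gK x; set u := g x => ua.
have xa' : x * a' = u by rewrite -ua -Na e loop_mulg1.
by rewrite xa' -{1}ua -Na K.
Qed.

(** For [a] in the left nucleus, [a'x'] is the inverse of [xa] and its left
translation factors as [L_a' L_x']; inverting this gives [L_(xa) = L_x L_a].
The converse inclusion is the mirror image. *)
Lemma left_nucleus_eq_middle (Q : loopType) :
  LIP Q -> left_nucleus Q = middle_nucleus Q.
Proof.
move=> lip; apply/seteqP; split=> a Na x y.
- have [a' aa'] := lip a; have [x' [_ xK]] := lip x.
  have Na' := left_nucleus_inv aa' Na.
  have [_ aK] := aa'; have [_ a'a] := linverse_mul aa'.
  apply: (@mul_injl _ (a' * x')); rewrite [RHS](LIP_cancel lip).
    by rewrite -Na' xK aK.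
  by rewrite -Na' xK.
- have [a' aa'] := lip a; have [x' xx'] := lip x.
  have Na' := middle_nucleus_inv aa' Na.
  have [_ aK] := aa'; have [_ xK] := xx'; have [_ x'x] := linverse_mul xx'.
  apply: (@mul_injl _ (x' * a')); rewrite [RHS](LIP_cancel lip).
    by rewrite -Na' aK xK.
  by rewrite -Na' aK.
Qed.

Lemma left_nucleus_mul (Q : loopType) (a b : Q) :
  left_nucleus Q a -> left_nucleus Q b -> left_nucleus Q (a * b).
Proof. by move=> Na Nb x y; rewrite -Na Nb Na Na. Qed.

Lemma left_nucleus_ldiv (Q : loopType) (a b : Q) : LIP Q ->
  left_nucleus Q a -> left_nucleus Q (a * b) -> left_nucleus Q b.
Proof.
move=> /(_ a)[a' aa'] Na Nab; have [_ aK] := aa'.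
by rewrite -(aK b); apply: left_nucleus_mul => //; exact: left_nucleus_inv Na.
Qed.

Lemma subloop_left_nucleus (Q : loopType) : LIP Q -> subloop (left_nucleus Q).
Proof.
move=> lip; split.
- by move=> x y; rewrite !loop_mul1g.
- exact: left_nucleus_mul.
- by move=> x y; exact: left_nucleus_ldiv.
- move=> x y Ny Nxy; have [y' yy'] := lip y; have [e _] := linverse_mul yy'.
  have My : middle_nucleus Q y by rewrite -left_nucleus_eq_middle.
  have -> : x = (x * y) * y' by rewrite -My e loop_mulg1.
  by apply: left_nucleus_mul => //; exact: left_nucleus_inv Ny.
Qed.

(** If [xx' = 1], the LC identity at [y = x'] reads [x(x(x'z)) = xz]. *)
Lemma LC_LIP (Q : loopType) : LC_loop Q -> LIP Q.
Proof.
move=> HQ x; have [g _ gK] := loop_ltrans_bij x; exists (g 1).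
have K y : x * (g 1 * y) = y.
  by apply: (@mul_injl _ x); rewrite /= HQ gK loop_mulg1.
by split=> // y; apply: (@mul_injl _ x); rewrite K.
Qed.

Lemma LC_left_alternative (Q : loopType) (HQ : LC_loop Q) (x y : Q) :
  x * (x * y) = (x * x) * y.
Proof. by have := HQ x 1 y; rewrite loop_mul1g loop_mulg1. Qed.

Lemma LC_square_nucleus (Q : loopType) (HQ : LC_loop Q) (x : Q) :
  left_nucleus Q (x * x).
Proof. by move=> y z; rewrite -!LC_left_alternative. Qed.

(** The element [x(nx)] is reached by dividing the square of [nx], which is
[n(x(nx))], by [n]; multiplying it by the square of [x'] gives [x'(nx)]. *)
Lemma nucleus_conj (Q : loopType) (HQ : LC_loop Q) (x x' n : Q) :
  linverse x x' -> left_nucleus Q n -> left_nucleus Q (x' * (n * x)).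
Proof.
move=> [_ xK] Nn.
have Nxnx : left_nucleus Q (x * (n * x)).
  apply: (left_nucleus_ldiv (LC_LIP HQ) Nn).
  by rewrite Nn; exact: LC_square_nucleus.
rewrite -(xK (n * x)) LC_left_alternative //.
by apply: left_nucleus_mul => //; exact: LC_square_nucleus.
Qed.

(** The element [m] is the conjugate [x(nx')].  A loop with only the left inverse
property need not satisfy [(yx')x = y], so [mx = xn] is obtained by cancelling
[x'] on the right, where [(mx)x' = m(xx')] because [m] lies in the nucleus. *)
Lemma nucleus_commutes (Q : loopType) (HQ : LC_loop Q) (x n : Q) :
  left_nucleus Q n -> exists2 m, left_nucleus Q m & x * n = m * x.
Proof.
move=> Nn; have lip := LC_LIP HQ; have [x' xx'] := lip x.
have Nm := nucleus_conj HQ (linverse_sym xx') Nn.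
exists (x * (n * x')) => //; apply: (@mul_injr _ x') => /=.
have Mn : middle_nucleus Q n by rewrite -left_nucleus_eq_middle.
by rewrite -Nm (linverse_mul xx').1 loop_mulg1 Mn.
Qed.

Lemma nucleus_commutes_sym (Q : loopType) (HQ : LC_loop Q) (x m : Q) :
  left_nucleus Q m -> exists2 n, left_nucleus Q n & m * x = x * n.
Proof.
move=> Nm; have [x' xx'] := LC_LIP HQ x.
by exists (x' * (m * x)); [exact: nucleus_conj Nm | rewrite xx'.1].
Qed.

Definition same_coset (Q : loopType) (x y : Q) : Prop :=
  exists2 n, left_nucleus Q n & y = n * x.

(** Right cosets make the case of right translations immediate; for left ones,
[z(nx) = (zn)x = (mz)x = m(zx)] as soon as [zn = mz].  An equivalence, rather
than an implication, is stated so that the permutations having this property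
are closed under inverses. *)
Lemma mult_group_same_coset (Q : loopType) (HQ : LC_loop Q) (f : Q -> Q) :
  mult_group Q f -> forall x y, same_coset x y <-> same_coset (f x) (f y).
Proof.
pose G := [set f : Q -> Q | bijective f /\
  forall x y, same_coset x y <-> same_coset (f x) (f y)].
suff [GP Ggen] : perm_group G /\ range (@ltrans Q) `|` range (@rtrans Q) `<=` G.
  by move=> /(_ G (conj GP Ggen))[].
split.
  split.
  - by move=> g [].
  - by split; [exists id | ].
  - move=> g h [bg Cg] [bh Ch]; split; first exact: bij_comp.
    by move=> x y; rewrite Ch Cg.
  - move=> g h [bg Cg] gK hK; split; first by exists g.
    by move=> x y; rewrite (Cg (h x)) !hK.
have Mid n : left_nucleus Q n -> middle_nucleus Q n.
  by rewrite (left_nucleus_eq_middle (LC_LIP HQ)).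
move=> _ [[z _ <-]|[z _ <-]]; split.
- exact: loop_ltrans_bij.
- move=> x y; rewrite /ltrans; split=> [[n Nn ->]|[m Nm e]].
    have [m Nm zn] := nucleus_commutes HQ z Nn.
    by exists m; rewrite // (Mid _ Nn) zn -Nm.
  have [n Nn mz] := nucleus_commutes_sym HQ z Nm.
  by exists n => //; apply: (@mul_injl _ z); rewrite /= e Nm mz -(Mid _ Nn).
- exact: loop_rtrans_bij.
- move=> x y; rewrite /rtrans; split=> [[n Nn ->]|[n Nn e]]; exists n => //.
  by apply: (@mul_injr _ z); rewrite /= e Nn.
Qed.

Lemma same_coset1 (Q : loopType) (y : Q) : same_coset 1 y <-> left_nucleus Q y.
Proof.
split=> [[n Nn ->]|Ny]; first by rewrite loop_mulg1.
by exists y; rewrite // loop_mulg1.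
Qed.

Theorem theorem2p11 (Q : loopType) (HQ : LC_loop Q) :
  left_nucleus Q = middle_nucleus Q /\ normal_subloop (left_nucleus Q).
Proof.
have lip := LC_LIP HQ; split; first exact: left_nucleus_eq_middle.
split; first exact: subloop_left_nucleus.
move=> f [Mf f1].
have fN y : left_nucleus Q y <-> left_nucleus Q (f y).
  by rewrite -!same_coset1 -{2}f1; exact: mult_group_same_coset.
have [/(_ f Mf)[g _ gK] _ _ _] := mult_groupP Q.
apply/seteqP; split=> [_ [y Ny <-]|y Ny]; first by rewrite -fN.
by exists (g y); rewrite /= 1?fN gK.
Qed.
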